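(* Write $\mathrm{Ric}_e\ge K$ for ''the entropic curvature is bounded from below by $K$'' (defined in the context), and consider the three models described in the context. (1) (Curie--Weiss) Let $0<\beta\le \frac12$. For each integer $N\ge 1$ let $\kappa_N$ be the supremum of all $K\in\mathbb{R}$ such that $\mathrm{Ric}_e\ge K$ for the Curie--Weiss model of size $N$ and parameter $\beta$. Then $$\liminf_{N\to\infty}\kappa_N\ \ge\ (1-\beta)+(1-2\beta)e^{-\beta}.$$ (2) (Ising) Let $d\ge1$ and $\beta>0$ with $2d\,(1-e^{-2\beta})\,e^{4d\beta}\le 1$. Then for the Ising model in dimension $d$ with parameter $\beta$ (on any finite connected $\Lambda\subset\mathbb{Z}^d$), $$\mathrm{Ric}_e\ \ge\ 1+e^{-2\beta d}-3d\,(1-e^{-2\beta})\,e^{2\beta d}.$$ (3) (Hardcore) Let $(V,E)$ be a simple finite connected graph with maximum degree $\Delta$, let $\beta>0$ with $\beta\Delta\le 1$, and set $\kappa_*=1-\beta(\Delta-1)$ and $\overline{\kappa_*}=\min\{\beta,1-\beta\Delta\}$. Then for the hardcore model on $(V,E)$ with parameter $\beta$, $$\mathrm{Ric}_e\ \ge\ \frac{\kappa_*}{2}+\overline{\kappa_*}.$$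
   Context: **Markov chains given by moves.** $\Omega$ is a finite state space, $G$ a finite set of moves (maps $\sigma:\Omega\to\Omega$; write $\sigma\eta$ for $\sigma(\eta)$), $c:\Omega\times G\to[0,\infty)$ the transition rates, and $m$ the reversible probability measure. The generator is $\mathcal{L}\psi(\eta)=\sum_{\sigma\in G}c(\eta,\sigma)(\psi(\sigma\eta)-\psi(\eta))$. Let $S=\{(\eta,\sigma)\in\Omega\times G: c(\eta,\sigma)>0\}$. **Entropic curvature.** Let $\theta(s,t)=\int_0^1 s^{1-p}t^p\,dp$ be the logarithmic mean on $(0,\infty)^2$. For $\rho:\Omega\to(0,\infty)$ and $\psi:\Omega\to\mathbb{R}$ put $$\mathscr{A}(\rho,\psi)=\tfrac12\sum_{(\eta,\sigma)\in S}m(\eta)c(\eta,\sigma)\,\theta(\rho(\eta),\rho(\sigma\eta))\,[\psi(\eta)-\psi(\sigma\eta)]^2,$$ $$\mathscr{C}(\rho,\psi)=\tfrac14\sum_{(\eta,\sigma)\in S}m(\eta)c(\eta,\sigma)\Big\{\partial_1\theta(\rho(\eta),\rho(\sigma\eta))\,\mathcal{L}\rho(\eta)+\partial_2\theta(\rho(\eta),\rho(\sigma\eta))\,\mathcal{L}\rho(\sigma\eta)\Big\}[\psi(\eta)-\psi(\sigma\eta)]^2,$$ $$\mathscr{D}(\rho,\psi)=\tfrac12\sum_{(\eta,\sigma)\in S}m(\eta)c(\eta,\sigma)\,\theta(\rho(\eta),\rho(\sigma\eta))(\psi(\eta)-\psi(\sigma\eta))(\mathcal{L}\psi(\eta)-\mathcal{L}\psi(\sigma\eta)),$$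 and $\mathscr{B}=\mathscr{C}-\mathscr{D}$. For $K\in\mathbb{R}$, $\mathrm{Ric}_e\ge K$ means $\mathscr{B}(\rho,\psi)\ge K\mathscr{A}(\rho,\psi)$ for all $\rho:\Omega\to(0,\infty)$ and $\psi:\Omega\to\mathbb{R}$. **Glauber dynamics.** For a Hamiltonian $H:\Omega\to\mathbb{R}$ and $\beta>0$: $c(\eta,\sigma)=\exp\big(-\tfrac{\beta}{2}(H(\sigma\eta)-H(\eta))\big)$ and $m(\eta)=\frac1{Z_\beta}e^{-\beta H(\eta)}$, with $Z_\beta$ the normalizing constant. - *Curie--Weiss model* of size $N$, parameter $\beta$: the Glauber dynamics with $\Omega=\{-1,1\}^N$, $G=\{\sigma_1,\dots,\sigma_N\}$ where $\sigma_i$ flips the $i$-th coordinate, $H(\eta)=-\frac1{2N}\sum_{i,j=1}^N\eta_i\eta_j$. - *Ising model* in dimension $d$, parameter $\beta$: $\Lambda\subset\mathbb{Z}^d$ is a finite connected set with the nearest-neighbour relation $\sim$ inherited from $\mathbb{Z}^d$; it is the Glauber dynamics with $\Omega=\{-1,1\}^\Lambda$, $G=\{\sigma_x\}_{x\in\Lambda}$ where $\sigma_x$ flips the spin at $x$, $H(\eta)=-\frac12\sum_{x\sim y}\eta_x\eta_y$, the sum being over ordered pairs $(x,y)\in\Lambda^2$ with $x\sim y$. **Hardcore model.** For the graph $(V,E)$, $x\sim y$ denotes adjacency and $\bar N_x=\{x\}\cup\{y:y\sim x\}$. $\Omega=\{\eta\in\{0,1\}^V:\eta_x\eta_y=0\text{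 if }x\sim y\}$. Moves $G=\{\gamma_x^+,\gamma_x^-:x\in V\}$: $\gamma_x^{\pm}\eta=\eta\pm\delta_x$ if this lies in $\Omega$, and $\gamma_x^\pm\eta=\eta$ otherwise, where $\delta_x$ is the indicator of $x$. Rates: $c(\eta,\gamma_x^+)=\beta\prod_{y\in\bar N_x}(1-\eta_y)$, $c(\eta,\gamma_x^-)=\eta_x$. Reversible measure: $m(\eta)=\frac1Z\prod_{x\in V}\beta^{\eta_x}$ on $\Omega$. *)

(* Defs.v *)
From HB Require Import structures.
From mathcomp Require Import all_boot all_order all_algebra finmap.
From mathcomp Require Import all_classical all_reals all_analysis.
Set Implicit Arguments.
Unset Strict Implicit.
Unset Printing Implicit Defensive.
Import Order.TTheory GRing.Theory Num.Theory.
Import numFieldNormedType.Exports.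
Local Open Scope ring_scope.

(* The moves are indexed by a finite type [label]; in every model below
   distinct labels give distinct maps, so this is a finite set of maps. *)
Record chain (R : realType) := Chain {
  state : finType;
  label : finType;
  move : label -> state -> state;
  rate : state -> label -> R;
  mass : state -> R
}.

Section Curvature.
Context {R : realType}.

Definition log_mean (s t : R) : R :=
  \int[lebesgue_measure]_(p in `[0, 1]%classic) (s `^ (1 - p) * t `^ p).

Definition d1_log_mean (s t : R) : R := derive1 (fun x : R => log_mean x t) s.
Definition d2_log_mean (s t : R) : R := derive1 (fun y : R => log_mean s y) t.

Variable M : chain R.
Local Notation c := (@rate R M).
Local Notation m := (@mass R M).
Local Notation "sg • eta" := (@move R M sg eta) (at level 35, right associativity).

Definition generator (psi : state M -> R) (eta : state M) : R :=
  \sum_sg c eta sg * (psi (sg • eta) - psi eta).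
Local Notation L := generator.

Definition actionA (rho psi : state M -> R) : R :=
  2^-1 * \sum_eta \sum_(sg | 0 < c eta sg)
    m eta * c eta sg * log_mean (rho eta) (rho (sg • eta))
    * (psi eta - psi (sg • eta)) ^+ 2.

Definition actionC (rho psi : state M -> R) : R :=
  4^-1 * \sum_eta \sum_(sg | 0 < c eta sg)
    m eta * c eta sg
    * (d1_log_mean (rho eta) (rho (sg • eta)) * L rho eta
       + d2_log_mean (rho eta) (rho (sg • eta)) * L rho (sg • eta))
    * (psi eta - psi (sg • eta)) ^+ 2.

Definition actionD (rho psi : state M -> R) : R :=
  2^-1 * \sum_eta \sum_(sg | 0 < c eta sg)
    m eta * c eta sg * log_mean (rho eta) (rho (sg • eta))
    * (psi eta - psi (sg • eta)) * (L psi eta - L psi (sg • eta)).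

Definition actionB (rho psi : state M -> R) : R :=
  actionC rho psi - actionD rho psi.

Definition Ric_ge (K : R) : Prop :=
  forall rho psi : state M -> R, (forall eta, 0 < rho eta) ->
    K * actionA rho psi <= actionB rho psi.

Definition Ric_sup : \bar R :=
  ereal_sup [set K%:E | K in [set K : R | Ric_ge K]]%classic.

End Curvature.

Section Glauber.
Context {R : realType}.

Definition glauber (Omega G : finType) (act : G -> Omega -> Omega)
    (H : Omega -> R) (beta : R) : chain R :=
  @Chain R Omega G act
    (fun eta sg => expR (- (beta / 2) * (H (act sg eta) - H eta)))
    (fun eta => (\sum_xi expR (- beta * H xi))^-1 * expR (- beta * H eta)).

(* A configuration in {-1,1}^V is a boolean function: true is the spin +1,
   false the spin -1. *)
Definition spin (V : finType) (eta : {ffun V -> bool}) (x : V) : R :=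
  if eta x then 1 else -1.

Definition flip (V : finType) (x : V) (eta : {ffun V -> bool}) :
    {ffun V -> bool} :=
  [ffun y => if y == x then ~~ eta y else eta y].

Definition curie_weiss_H (N : nat) (eta : {ffun 'I_N -> bool}) : R :=
  - (2 * N%:R)^-1 * \sum_(i < N) \sum_(j < N) spin eta i * spin eta j.

Definition curie_weiss (N : nat) (beta : R) : chain R :=
  glauber (@flip 'I_N) (@curie_weiss_H N) beta.

End Glauber.

Section Ising.
Context {R : realType} (d : nat).

Definition lattice_adj (x y : 'rV[int]_d) : bool :=
  \sum_(i < d) `|x 0 i - y 0 i| == 1.

Definition lattice_connected (Lam : {fset 'rV[int]_d}) : Prop :=
  forall x y : Lam, connect (fun u v : Lam => lattice_adj (val u) (val v)) x y.

Definition ising_H (Lam : {fset 'rV[int]_d}) (eta : {ffun Lam -> bool}) : R :=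
  - 2^-1 * \sum_(x : Lam) \sum_(y : Lam | lattice_adj (val x) (val y))
    spin eta x * spin eta y.

Definition ising (Lam : {fset 'rV[int]_d}) (beta : R) : chain R :=
  glauber (@flip Lam) (@ising_H Lam) beta.

End Ising.

Section Hardcore.
Context {R : realType} (V : finType) (e : rel V).

Definition max_degree : nat := \max_(x : V) #|[pred y | e x y]|.

Definition independent (eta : {ffun V -> bool}) : bool :=
  [forall x, forall y, e x y ==> ~~ (eta x && eta y)].

Definition hc_state : finType := {eta : {ffun V -> bool} | independent eta}.

(* The label (x, true) is gamma_x^+ and (x, false) is gamma_x^-.  When
   eta + delta_x (resp. eta - delta_x) leaves {0,1}^V, overwriting the value
   at x does not change eta; when it leaves only the independent
   configurations, insubd returns its default eta. *)
Definition hc_move (g : V * bool) (eta : hc_state) : hc_state :=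
  insubd eta [ffun y => if y == g.1 then g.2 else val eta y].

Definition hc_rate (beta : R) (eta : hc_state) (g : V * bool) : R :=
  if g.2 then beta * \prod_(y | (y == g.1) || e g.1 y) (1 - (val eta y)%:R)
  else (val eta g.1)%:R.

Definition hc_weight (beta : R) (eta : hc_state) : R :=
  \prod_(x : V) beta ^+ (val eta x).

Definition hardcore (beta : R) : chain R :=
  @Chain R hc_state (V * bool)%type hc_move (hc_rate beta)
    (fun eta => (\sum_xi hc_weight beta xi)^-1 * hc_weight beta eta).

End Hardcore.

(* Main.v *)
Require Import Defs.
From HB Require Import structures.
From mathcomp Require Import all_boot all_order all_algebra finmap.
From mathcomp Require Import all_classical all_reals all_analysis.
From mathcomp Require Import ring lra zify.
Set Implicit Arguments.
Unset Strict Implicit.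
Unset Printing Implicit Defensive.
Import Order.TTheory GRing.Theory Num.Theory.
Import numFieldNormedType.Exports.
Local Open Scope ring_scope.

(* Couple the jumps of the two endpoints of an edge [(eta, tau x eta)]: flips at
   [y != x] are performed jointly at the smaller of the two rates, the surplus at
   one endpoint is paired with the flip of [x] at the other, and what remains of
   the flips of [x] merges the pair.  As the logarithmic mean is concave and
   1-homogeneous, each coupled jump contributes to [B] at least a difference
   of edge terms.  By reversibility and the symmetry
   [q eta x * q (tau x eta) y = q eta y * q (tau y eta) x], the differences
   coming from joint flips cancel under [eta -> tau y eta], those coming from
   surpluses cancel under the exchange of [x] and [y], and only the merging jumps
   are left.  With merging rates [k] and [k'], the bound
   [log_mean s t <= (s + t) / 2] turns them into a curvature of
   [(k + k') / 2 + min k k'].  For the Curie-Weiss model the resulting lower bound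
   already holds for every finite [N]. *)

(** * The logarithmic mean: symmetry, comparison with the arithmetic mean, differential *)

Section LogMean.
Context {R : realType}.
Local Notation mu := (@lebesgue_measure R).
Local Notation I01 := (`[0%R, 1%R]%classic : set R).

(** The exponential lies above its tangent at [c], the logarithm of the left-hand side; averaging
    this at [ln a] and [ln b] with weights [1 - p] and [p] cancels the linear terms. *)
Lemma young_powR (a b p : R) : 0 < a -> 0 < b -> 0 <= p <= 1 ->
  a `^ (1 - p) * b `^ p <= (1 - p) * a + p * b.
Proof.
move=> a0 b0 /andP[p0 p1].
rewrite /powR (gt_eqF a0) (gt_eqF b0) -expRD.
set c := (_ + _ : R).
have E (z : R) : 0 < z -> expR c * (1 + (ln z - c)) <= z.
  move=> z0; apply: (@le_trans _ _ (expR c * expR (ln z - c))).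
    by rewrite ler_wpM2l ?expR_ge0// expR_ge1Dx.
  by rewrite -expRD subrKC lnK.
have Ea := E _ a0; have Eb := E _ b0.
have q0 : 0 <= 1 - p by lra.
have := lerD (ler_wpM2l q0 Ea) (ler_wpM2l p0 Eb); apply: le_trans.
rewrite le_eqVlt; apply/orP; left; apply/eqP.
have Ec : c = (1 - p) * ln a + p * ln b by [].
rewrite Ec; ring.
Qed.

Lemma continuous_powR2 (s t : R) : 0 < s -> 0 < t ->
  continuous (fun p : R => s `^ (1 - p) * t `^ p).
Proof.
move=> s0 t0 p.
rewrite /powR (gt_eqF s0) (gt_eqF t0).
apply: cvgM; apply: continuous_comp; try exact: continuous_expR.
  by apply: cvgM; [apply: cvgB; [exact: cvg_cst|exact: cvg_id]|exact: cvg_cst].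
by apply: cvgM; [exact: cvg_id|exact: cvg_cst].
Qed.

Lemma integrable01 (f : R -> R) : continuous f ->
  mu.-integrable I01 (EFin \o f).
Proof.
move=> cf; apply: continuous_compact_integrable; first exact: segment_compact.
exact: continuous_subspaceT.
Qed.

Lemma Rintegral01_cst (r : R) : \int[mu]_(p in I01) r = r.
Proof.
have mu1 : mu `[0, 1]%classic = 1%:E.
  by rewrite lebesgue_measure_itv/= lte_fin ltr01 sube0.
by rewrite Rintegral_cst ?measurable_itv// [X in fine X]mu1 mulr1.
Qed.

Lemma Rintegral01_onem (f : R -> R) : continuous f ->
  \int[mu]_(p in I01) f (1 - p) = \int[mu]_(p in I01) f p.
Proof.
move=> cf; rewrite [RHS]Rintegration_by_substitution_onem ?ler01 ?lexx//.
  by rewrite /unstable.onem subrr.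
exact: continuous_subspaceT.
Qed.

Lemma log_meanC (s t : R) : 0 < s -> 0 < t -> log_mean s t = log_mean t s.
Proof.
move=> s0 t0; rewrite /log_mean -[RHS]Rintegral01_onem; last exact: continuous_powR2.
by apply: eq_Rintegral => p _; rewrite subKr mulrC.
Qed.

Lemma log_mean_ge0 (s t : R) : 0 <= log_mean s t.
Proof. by apply: Rintegral_ge0 => p _; rewrite mulr_ge0 ?powR_ge0. Qed.

Lemma log_mean_id (s : R) : 0 < s -> log_mean s s = s.
Proof.
move=> s0; rewrite -[RHS]Rintegral01_cst; apply: eq_Rintegral => p _.
rewrite -powRD ?subrK ?powRr1 ?ltW//.
by rewrite (gt_eqF s0) implybT.
Qed.

(** Adding the integrals for [(s, t)] and [(t, s)] makes the two Young bounds sum to the constant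
    [s + t]. *)
Lemma log_mean_le_mean (s t : R) : 0 < s -> 0 < t -> log_mean s t <= (s + t) / 2.
Proof.
move=> s0 t0; suff : log_mean s t + log_mean t s <= s + t.
  by rewrite (log_meanC t0 s0); lra.
have cs := continuous_powR2 s0 t0; have ct := continuous_powR2 t0 s0.
rewrite {1}/log_mean -RintegralD ?integrable01//.
rewrite -[leRHS]Rintegral01_cst.
apply: le_Rintegral => //.
- by apply: integrable01 => p; apply: cvgD; [exact: cs|exact: ct].
- by apply: integrable01 => p; exact: cvg_cst.
- move=> p /=; rewrite in_itv/= => p01.
  have := young_powR s0 t0 p01; have := young_powR t0 s0 p01; lra.
Qed.

Let d (s t p : R) : R := (1 - p) * (s^-1 * (s `^ (1 - p) * t `^ p)).

Lemma continuous_d (s t : R) : 0 < s -> 0 < t -> continuous (d s t).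
Proof.
move=> s0 t0 p; apply: cvgM; first by apply: cvgB; [exact: cvg_cst|exact: cvg_id].
by apply: cvgM; [exact: cvg_cst|exact: continuous_powR2].
Qed.

Lemma d1_log_meanE (s t : R) : 0 < s -> 0 < t ->
  d1_log_mean s t = \int[mu]_(p in I01) d s t p.
Proof.
move=> s0 t0.
pose f (x p : R) := x `^ (1 - p) * t `^ p.
have d1E (x p : R) : 0 < x -> is_derive x (1:R) (f ^~ p) (d x t p).
  move=> x0; rewrite /f.
  have -> : d x t p = t `^ p * ((1 - p) * x `^ (1 - p - 1)).
    have -> : x `^ (1 - p - 1) = x `^ (1 - p) * x^-1.
      by rewrite powRB ?(gt_eqF x0) ?implybT// powRr1// ltW.
    by rewrite /d; ring.
  have H := is_derive1_powR (1 - p) x0.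
  have -> : (fun x0 : R => x0 `^ (1 - p) * t `^ p) = (t `^ p) \*: (@powR R ^~ (1 - p)).
    by apply/funext => z; rewrite /= mulrC.
  exact: is_deriveZ.
rewrite /d1_log_mean /log_mean.
(* Domination on [s / 2 < x < s + 1]: there [x^-1 <= 2 / s], and Young's inequality bounds the
   integrand by [s + 1 + t]. *)
rewrite (@differentiation_under_integral R _ _ mu f I01 _ s (s / 2) (s + 1) _ _ _
  (cst (2 / s * (s + 1 + t)))).
- apply: eq_Rintegral => p _.
  by rewrite partial1of2E; apply/derive_val/d1E.
- exact: measurable_itv.
- by rewrite /= in_itv/=; apply/andP; split; lra.
- move=> x; rewrite /= in_itv/= => /andP[x1 x2].
  by apply/integrable01/continuous_powR2 => //; lra.
- move=> x p; rewrite /= in_itv/= => /andP[x1 x2] _.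
  have x0 : 0 < x by lra.
  by have := d1E x p x0; case.
- by move=> p; rewrite /= mulr_ge0 ?divr_ge0//; lra.
- by apply: integrable01 => p; exact: cvg_cst.
- move=> x p; rewrite /= !in_itv/= => /andP[x1 x2] p01.
  have x0 : 0 < x by lra.
  have -> : partial1of2 f x p = d x t p by rewrite partial1of2E; apply/derive_val/d1E.
  have F0 : 0 <= x `^ (1 - p) * t `^ p by rewrite mulr_ge0 ?powR_ge0.
  have Fle := young_powR x0 t0 p01.
  have V0 : 0 <= x^-1 by rewrite invr_ge0 ltW.
  have Vle : x^-1 <= 2 / s.
    by rewrite -invf_div lef_pV2 ?posrE ?divr_gt0//; lra.
  have /andP[p0 p1] := p01.
  rewrite /d ger0_norm; last by apply: mulr_ge0; [lra|exact: mulr_ge0].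
  apply: (@le_trans _ _ (1 * (x^-1 * (x `^ (1 - p) * t `^ p)))).
    by apply: ler_wpM2r; [rewrite mulr_ge0|lra].
  rewrite mul1r; apply: ler_pM => //; apply: (le_trans Fle); nra.
Qed.

Lemma d2_log_meanE (s t : R) : 0 < s -> 0 < t ->
  d2_log_mean s t = \int[mu]_(p in I01) (p * (t^-1 * (s `^ (1 - p) * t `^ p))).
Proof.
move=> s0 t0; transitivity (d1_log_mean t s).
  rewrite /d2_log_mean /d1_log_mean !derive1E; apply: near_eq_derive.
  near=> x; apply: log_meanC => //.
  by near: x; exact: lt_nbhsr.
rewrite (d1_log_meanE t0 s0) -(Rintegral01_onem (continuous_d t0 s0)).
by apply: eq_Rintegral => p _; rewrite /d subKr (mulrC (t `^ _)).
Unshelve. end_near. Qed.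

Let d12 (s t a b p : R) : R :=
  (a / s * (1 - p) + b / t * p) * (s `^ (1 - p) * t `^ p).

Lemma d12_log_meanE (s t a b : R) : 0 < s -> 0 < t ->
  d1_log_mean s t * a + d2_log_mean s t * b = \int[mu]_(p in I01) d12 s t a b p.
Proof.
move=> s0 t0; rewrite d1_log_meanE// d2_log_meanE//.
have c2 : continuous (fun p : R => p * (t^-1 * (s `^ (1 - p) * t `^ p))).
  move=> p; apply: cvgM; first exact: cvg_id.
  by apply: cvgM; [exact: cvg_cst|exact: continuous_powR2].
rewrite -!RintegralZr//; [|exact/integrable01..|exact/integrable01/continuous_d].
rewrite -RintegralD//.
- by apply: eq_Rintegral => p _; rewrite /d /d12; ring.
- apply: integrable01 => p; apply: cvgM; [exact: continuous_d|exact: cvg_cst].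
- apply: integrable01 => p; apply: cvgM; [exact: c2|exact: cvg_cst].
Qed.

(** Euler's identity for a 1-homogeneous function; it turns the differential along
    [(r1 - s, r2 - t)] into the one along [(r1, r2)] minus [log_mean s t]. *)
Lemma log_mean_euler (s t : R) : 0 < s -> 0 < t ->
  d1_log_mean s t * s + d2_log_mean s t * t = log_mean s t.
Proof.
move=> s0 t0; rewrite d12_log_meanE//; apply: eq_Rintegral => p _.
by rewrite /d12 !divff ?gt_eqF// !mul1r subrK mul1r.
Qed.

(* A concave 1-homogeneous function lies below its differentials. *)
Lemma log_mean_le_diff (s t a b : R) : 0 < s -> 0 < t -> 0 < a -> 0 < b ->
  log_mean a b <= d1_log_mean s t * a + d2_log_mean s t * b.
Proof.
move=> s0 t0 a0 b0; rewrite d12_log_meanE//; apply: le_Rintegral => //.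
- exact/integrable01/continuous_powR2.
- apply: integrable01 => p; apply: cvgM; last exact: continuous_powR2.
  apply: cvgD; (apply: cvgM; first exact: cvg_cst); last exact: cvg_id.
  by apply: cvgB; [exact: cvg_cst|exact: cvg_id].
- move=> p; rewrite /= in_itv/= => p01.
  have as0 : 0 < a / s by rewrite divr_gt0.
  have bt0 : 0 < b / t by rewrite divr_gt0.
  (* Young's inequality for these ratios is to be multiplied by the integrand at [(s, t)]. *)
  have Y := young_powR as0 bt0 p01.
  have -> : a `^ (1 - p) * b `^ p =
      ((a / s) `^ (1 - p) * (b / t) `^ p) * (s `^ (1 - p) * t `^ p).
    rewrite mulrACA -!powRM ?divfK ?gt_eqF// ltW//.
  rewrite /d12 (mulrC (a / s)) (mulrC (b / t)).
  by apply: ler_wpM2r => //; rewrite mulr_ge0 ?powR_ge0.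
Qed.

End LogMean.

(** * Reversible systems of involutive flips *)

Section FlipSystemDef.
Context {R : realType} (Omega V : finType).
Context (tau : V -> Omega -> Omega) (q : Omega -> V -> R) (m : Omega -> R).

(** The last two relations are asked only at positive rates because of exclusion: hardcore
    insertions at adjacent vertices do not commute, and removing a particle may unblock a
    neighbour. *)
Record flip_system : Prop := FlipSystem {
  mass_gt0 : forall eta, 0 < m eta;
  flip_rate_ge0 : forall eta x, 0 <= q eta x;
  flipK : forall x, involutive (tau x);
  flip_reversible :
    forall eta x, m eta * q eta x = m (tau x eta) * q (tau x eta) x;
  flip_square : forall eta x y, x != y -> 0 < q eta x -> 0 < q eta y ->
    q eta x * q (tau x eta) y = q eta y * q (tau y eta) x;
  flip_commute : forall eta x y, x != y -> 0 < q eta x -> 0 < q eta y ->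
    0 < q (tau x eta) y -> tau x (tau y eta) = tau y (tau x eta)
}.

Definition excess (eta : Omega) (x y : V) : R :=
  Num.max 0 (q eta y - q (tau x eta) y).

(* The rate at which the coupling of [eta] and [tau x eta] merges the two by
   flipping [x] in [eta] alone. *)
Definition merge_rate (eta : Omega) (x : V) : R :=
  q eta x - \sum_(y | y != x) excess (tau x eta) x y.

Definition flip_generator (f : Omega -> R) (eta : Omega) : R :=
  \sum_y q eta y * (f (tau y eta) - f eta).

(** The contribution to [actionB] of the oriented edge from [eta] to [tau x eta], without its weight
    [m eta * q eta x]. *)
Definition edge_B (rho psi : Omega -> R) (eta : Omega) (x : V) : R :=
  4^-1 * (d1_log_mean (rho eta) (rho (tau x eta)) * flip_generator rho eta
          + d2_log_mean (rho eta) (rho (tau x eta))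
            * flip_generator rho (tau x eta))
       * (psi eta - psi (tau x eta)) ^+ 2
  - 2^-1 * (log_mean (rho eta) (rho (tau x eta)) * (psi eta - psi (tau x eta))
            * (flip_generator psi eta - flip_generator psi (tau x eta))).

End FlipSystemDef.

(** * The curvature bound for flip systems *)

Section FlipSystem.
Context {R : realType} (Omega V : finType).
Context (tau : V -> Omega -> Omega) (q : Omega -> V -> R) (m : Omega -> R).
Context (sys : flip_system tau q m).

Local Notation exc := (excess tau q).
Local Notation merge := (merge_rate tau q).
Local Notation L := (flip_generator tau q).

Let m_gt0 := mass_gt0 sys.
Let q_ge0 := flip_rate_ge0 sys.
Let tauK := flipK sys.
Let rev := flip_reversible sys.
Let square := flip_square sys.
Let commute := flip_commute sys.

Let common eta x y : R := Num.min (q eta y) (q (tau x eta) y).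

Let common_tau eta x y : common (tau x eta) x y = common eta x y.
Proof. by rewrite /common tauK minC. Qed.

Let excess_ge0 eta x y : 0 <= exc eta x y.
Proof. by rewrite le_max lexx. Qed.

(* The coupling of [eta] and [tau x eta]: a flip at [y != x] occurs in both at the
   smaller of the two rates, and the surplus is paired with a flip of [x] in the
   other configuration. *)
Let other_jump f eta x y : R :=
  common eta x y * (f (tau y eta) - f eta)
  + exc eta x y * (f (tau y eta) - f eta)
  + exc (tau x eta) x y * (f (tau x eta) - f eta).

(** The marginal of the coupling at [eta]: for [y != x], [q eta y] is [common] plus [exc], while
    [q eta x] is the total surplus at the other endpoint plus the merging rate. *)
Let L_split f eta x : L f eta =
  \sum_(y | y != x) other_jump f eta x y
  + merge eta x * (f (tau x eta) - f eta).
Proof.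
rewrite /flip_generator (bigD1 x)//= big_split/= -mulr_suml -[RHS]addrA -mulrDl.
rewrite /merge_rate subrKC addrC; congr (_ + _).
apply: eq_bigr => y yx; rewrite -mulrDl; congr (_ * _).
by rewrite /common /excess; case: leP => h; case: leP; move: h; lra.
Qed.

Context (rho psi : Omega -> R) (rho_gt0 : forall eta, 0 < rho eta).

Let th eta x := log_mean (rho eta) (rho (tau x eta)).
Let g eta x := (psi eta - psi (tau x eta)) ^+ 2.

Local Notation edgeB := (edge_B tau q rho psi).

Let th_tau eta x : th (tau x eta) x = th eta x.
Proof. by rewrite /th tauK log_meanC. Qed.

Let g_tau eta x : g (tau x eta) x = g eta x.
Proof. by rewrite /g tauK -sqrrN opprB. Qed.

(* The contribution to [edge_B] of a coupled jump of [(eta, tau x eta)] to a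
   pair where [rho] takes the values [(r1, r2)] and [psi] the values
   [(p1, p2)]. *)
Let jump eta x r1 r2 p1 p2 : R :=
  4^-1 * (d1_log_mean (rho eta) (rho (tau x eta)) * (r1 - rho eta)
          + d2_log_mean (rho eta) (rho (tau x eta)) * (r2 - rho (tau x eta)))
       * g eta x
  - 2^-1 * (th eta x * (psi eta - psi (tau x eta))
            * ((p1 - p2) - (psi eta - psi (tau x eta)))).

(** Concavity and Euler's identity bound the [rho] part; in the [psi] part a square is completed,
    and what is dropped is [th eta x] times the squared change of the [psi] difference. *)
Let jump_ge eta x r1 r2 p1 p2 : 0 < r1 -> 0 < r2 ->
  4^-1 * (log_mean r1 r2 * g eta x - th eta x * (p1 - p2) ^+ 2)
    <= jump eta x r1 r2 p1 p2.
Proof.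
move=> r10 r20; rewrite /jump.
have H := log_mean_le_diff (rho_gt0 eta) (rho_gt0 (tau x eta)) r10 r20.
have E := log_mean_euler (rho_gt0 eta) (rho_gt0 (tau x eta)).
have T0 : 0 <= th eta x by exact: log_mean_ge0.
rewrite -/(th _ _) in E; move: H E T0; rewrite /g.
set t := th _ _; set a := psi eta - _; set b := p1 - p2.
set D1 := d1_log_mean _ _; set D2 := d2_log_mean _ _ => H E T0.
have -> : D1 * (r1 - rho eta) + D2 * (r2 - rho (tau x eta))
   = (D1 * r1 + D2 * r2) - t by rewrite -E; ring.
have := ler_wpM2r (sqr_ge0 a) H.
have := mulr_ge0 T0 (sqr_ge0 (a - b)).
lra.
Qed.

(** The [psi] difference vanishes after a merge, so no square is dropped and the term in [th eta x]
    survives. *)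
Let jump_merge eta x r p : 0 < r ->
  4^-1 * ((r + th eta x) * g eta x) <= jump eta x r r p p.
Proof.
move=> r0; rewrite /jump.
have H := log_mean_le_diff (rho_gt0 eta) (rho_gt0 (tau x eta)) r0 r0.
have E := log_mean_euler (rho_gt0 eta) (rho_gt0 (tau x eta)).
rewrite -/(th _ _) in E; move: H E; rewrite log_mean_id// /g.
set t := th _ _; set a := psi eta - _.
set D1 := d1_log_mean _ _; set D2 := d2_log_mean _ _ => H E.
have -> : D1 * (r - rho eta) + D2 * (r - rho (tau x eta))
   = (D1 * r + D2 * r) - t by rewrite -E; ring.
have := ler_wpM2r (sqr_ge0 a) H.
lra.
Qed.

(** [edge_B] is linear in the increments at both endpoints, so [L_split] at [eta] and at [tau x eta]
    breaks it up over the coupled jumps. *)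
Let edge_B_jumps eta x : edgeB eta x =
  \sum_(y | y != x)
    (common eta x y * jump eta x (rho (tau y eta)) (rho (tau y (tau x eta)))
                                 (psi (tau y eta)) (psi (tau y (tau x eta)))
     + exc eta x y * jump eta x (rho (tau y eta)) (rho eta)
                                   (psi (tau y eta)) (psi eta)
     + exc (tau x eta) x y
       * jump eta x (rho (tau x eta)) (rho (tau y (tau x eta)))
                    (psi (tau x eta)) (psi (tau y (tau x eta))))
  + merge eta x * jump eta x (rho (tau x eta)) (rho (tau x eta))
                                  (psi (tau x eta)) (psi (tau x eta))
  + merge (tau x eta) x * jump eta x (rho eta) (rho eta) (psi eta) (psi eta).
Proof.
have lin4 (I : finType) (P : pred I) (a b c d : R) (A B C D : I -> R) :
    \sum_(i | P i) (a * A i + b * B i + c * C i + d * D i) =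
    a * (\sum_(i | P i) A i) + b * (\sum_(i | P i) B i)
    + c * (\sum_(i | P i) C i) + d * (\sum_(i | P i) D i).
  by rewrite !mulr_sumr -!big_split.
rewrite /edge_B !(L_split _ _ x) -/(th eta x) -/(g eta x).
have -> : \sum_(y | y != x)
    (common eta x y * jump eta x (rho (tau y eta)) (rho (tau y (tau x eta)))
                                 (psi (tau y eta)) (psi (tau y (tau x eta)))
     + exc eta x y * jump eta x (rho (tau y eta)) (rho eta)
                                   (psi (tau y eta)) (psi eta)
     + exc (tau x eta) x y
       * jump eta x (rho (tau x eta)) (rho (tau y (tau x eta)))
                    (psi (tau x eta)) (psi (tau y (tau x eta))))
  = (4^-1 * d1_log_mean (rho eta) (rho (tau x eta)) * g eta x)
      * \sum_(y | y != x) other_jump rho eta x y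
    + (4^-1 * d2_log_mean (rho eta) (rho (tau x eta)) * g eta x)
      * \sum_(y | y != x) other_jump rho (tau x eta) x y
    + (- 2^-1 * (th eta x * (psi eta - psi (tau x eta))))
      * \sum_(y | y != x) other_jump psi eta x y
    + (2^-1 * (th eta x * (psi eta - psi (tau x eta))))
      * \sum_(y | y != x) other_jump psi (tau x eta) x y.
  rewrite -lin4; apply: eq_bigr => y yx.
  rewrite /other_jump common_tau tauK /jump.
  move: (d1_log_mean _ _) (d2_log_mean _ _) (th _ _) (g _ _) => D1 D2 t gx.
  move: (common _ _ _) (exc _ _ _) (exc _ _ _) => k1 k2 k3.
  by ring.
rewrite /jump tauK.
move: (d1_log_mean _ _) (d2_log_mean _ _) (th _ _) (g _ _) => D1 D2 t gx.
move: (merge _ _) (merge _ _) => k1 k2.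
move: (\sum_(y | y != x) other_jump rho _ x y)
  (\sum_(y | y != x) other_jump rho _ x y)
  (\sum_(y | y != x) other_jump psi _ x y)
  (\sum_(y | y != x) other_jump psi _ x y) => S1 S2 S3 S4.
by ring.
Qed.

Let parallel eta x y : R :=
  common eta x y
  * (log_mean (rho (tau y eta)) (rho (tau y (tau x eta))) * g eta x
     - th eta x * (psi (tau y eta) - psi (tau y (tau x eta))) ^+ 2).

(** A surplus flip of [y] at [eta] leads to the pair [(tau y eta, eta)], an edge in direction [y] at
    the same state; the resulting difference is antisymmetric in [x] and [y]. *)
Let cross eta x y : R := th eta y * g eta x - th eta x * g eta y.

Let q_tau_gt0 eta x : (0 < q (tau x eta) x) = (0 < q eta x).
Proof. by rewrite -(pmulr_rgt0 _ (m_gt0 (tau x eta))) -rev pmulr_rgt0. Qed.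

Context (merge_ge0 : forall eta x, 0 < q eta x -> 0 <= merge eta x).

Let edge_B_ge eta x : 0 < q eta x ->
  4^-1 * (\sum_(y | y != x)
            (parallel eta x y + exc eta x y * cross eta x y
             + exc (tau x eta) x y * cross (tau x eta) x y)
          + (merge eta x * (rho (tau x eta) + th eta x)
             + merge (tau x eta) x * (rho eta + th eta x)) * g eta x)
    <= edgeB eta x.
Proof.
move=> qx; rewrite edge_B_jumps mulrDr mulr_sumr -addrA; apply: lerD.
  apply: ler_sum => y yx.
  have c0 : 0 <= common eta x y by rewrite le_min !q_ge0.
  have := ler_wpM2l c0 (jump_ge eta x (psi (tau y eta)) (psi (tau y (tau x eta)))
    (rho_gt0 (tau y eta)) (rho_gt0 (tau y (tau x eta)))).
  have := ler_wpM2l (excess_ge0 eta x y) (jump_ge eta x (psi (tau y eta)) (psi eta)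
    (rho_gt0 (tau y eta)) (rho_gt0 eta)).
  have := ler_wpM2l (excess_ge0 (tau x eta) x y)
    (jump_ge eta x (psi (tau x eta)) (psi (tau y (tau x eta)))
      (rho_gt0 (tau x eta)) (rho_gt0 (tau y (tau x eta)))).
  rewrite /cross th_tau g_tau -(sqrrN (psi (tau y eta) - psi eta)) opprB.
  rewrite (log_meanC (rho_gt0 (tau y eta)) (rho_gt0 eta)).
  rewrite -/(th eta y) -/(g eta y) -/(th (tau x eta) y) -/(g (tau x eta) y).
  rewrite /parallel.
  move: (jump _ _ _ _ _ _) (jump _ _ _ _ _ _) (jump _ _ _ _ _ _) => j1 j2 j3.
  move: (common _ _ _) (exc _ _ _) (exc _ _ _) => k1 k2 k3.
  move: (th _ _) (th _ _) (th _ _) (g _ _) (g _ _) (g _ _) => t1 t2 t3 g1 g2 g3.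
  lra.
have k1 := merge_ge0 qx.
have k2 : 0 <= merge (tau x eta) x by apply: merge_ge0; rewrite q_tau_gt0.
have := ler_wpM2l k1 (jump_merge eta x (psi (tau x eta)) (rho_gt0 (tau x eta))).
have := ler_wpM2l k2 (jump_merge eta x (psi eta) (rho_gt0 eta)).
move: (jump _ _ _ _ _ _) (jump _ _ _ _ _ _) (merge _ _) (merge _ _).
move: (th _ _) (g _ _) (rho _) (rho _) => t gg r1 r2 l1 l2 j1 j2.
lra.
Qed.

Let w eta x y : R := m eta * q eta x * common eta x y.

Let w_ge0 eta x y : 0 <= w eta x y.
Proof. by rewrite !mulr_ge0 ?(ltW (m_gt0 _))// le_min !q_ge0. Qed.

Let w_gt0P eta x y : 0 < w eta x y ->
  [/\ 0 < q eta x, 0 < q eta y & 0 < q (tau x eta) y].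
Proof.
move=> w0; split; move: w0; apply: contraTT; rewrite -!leNgt /w => h.
- by rewrite (_ : q eta x = 0) ?mulr0 ?mul0r//; apply/le_anti; rewrite h q_ge0.
- apply: mulr_ge0_le0; first by rewrite mulr_ge0 ?(ltW (m_gt0 _)).
  by rewrite ge_min h.
- apply: mulr_ge0_le0; first by rewrite mulr_ge0 ?(ltW (m_gt0 _)).
  by rewrite ge_min h orbT.
Qed.

(** With the prefactor moved inside the minimum, reversibility and [square] show that [tau y]
    exchanges its two arguments. *)
Let w_tau_gt0 eta x y : x != y -> 0 < w eta x y -> w (tau y eta) x y = w eta x y.
Proof.
move=> xy /w_gt0P[qx qy qxy].
have sq := square xy qx qy.
have qyx : 0 < q (tau y eta) x.
  by rewrite -(pmulr_rgt0 _ qy) -sq mulr_gt0.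
have qyy : 0 < q (tau y eta) y by rewrite q_tau_gt0.
have sq' := square xy qyx qyy; rewrite tauK in sq'.
have E1 : m (tau y eta) * q (tau y eta) x * q (tau y eta) y
    = m eta * q eta x * q (tau x eta) y.
  by rewrite mulrAC -rev -!mulrA -sq.
have E2 : m (tau y eta) * q (tau y eta) x * q (tau x (tau y eta)) y
    = m eta * q eta x * q eta y.
  by rewrite -mulrA sq' mulrA -rev mulrAC.
by rewrite /w /common !minr_pMr ?mulr_ge0 ?(ltW (m_gt0 _))// E1 E2 minC.
Qed.

Let w_tau eta x y : x != y -> w (tau y eta) x y = w eta x y.
Proof.
move=> xy; have [/(w_tau_gt0 xy)//|w0] := ltP 0 (w eta x y).
have [/(w_tau_gt0 xy)|w1] := ltP 0 (w (tau y eta) x y); first by rewrite tauK.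
by transitivity (0 : R); apply/le_anti; rewrite ?w0 ?w1 w_ge0.
Qed.

(* Parallel jumps along [y] exchange the edges [(eta, tau x eta)] and
   [(tau y eta, tau x (tau y eta))] at equal rates. *)
Let sum_parallel x y : x != y ->
  \sum_eta m eta * q eta x * parallel eta x y = 0.
Proof.
move=> xy.
have E eta : m eta * q eta x * parallel eta x y =
    w eta x y * (th (tau y eta) x * g eta x)
    - w eta x y * (th eta x * g (tau y eta) x).
  transitivity (w eta x y
     * (log_mean (rho (tau y eta)) (rho (tau y (tau x eta))) * g eta x
     - th eta x * (psi (tau y eta) - psi (tau y (tau x eta))) ^+ 2)).
    exact: mulrA.
  have := w_ge0 eta x y; rewrite le_eqVlt => /predU1P[<-|/w_gt0P[qx qy qxy]].
    by rewrite !mul0r subr0.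
  rewrite -(commute xy qx qy qxy).
  exact: mulrBr.
under eq_bigr do rewrite E.
rewrite sumrB; apply/eqP; rewrite subr_eq0; apply/eqP.
rewrite (reindex_inj (inv_inj (tauK y))); apply: eq_bigr => eta _.
by rewrite tauK w_tau.
Qed.

(** By [square] both sides are the positive part of one quantity; when either rate is zero, both
    vanish. *)
Let W_sym eta x y : x != y ->
  m eta * q eta x * exc eta x y = m eta * q eta y * exc eta y x.
Proof.
move=> xy; rewrite /excess !maxr_pMr ?mulr_ge0 ?(ltW (m_gt0 _))// !mulr0.
have [qx|] := ltP 0 (q eta x); last first.
  move=> h; have -> : q eta x = 0 by apply/le_anti; rewrite h q_ge0.
  rewrite mulr0 mul0r sub0r max_l// ?max_l// mulrN oppr_le0.
  by rewrite !mulr_ge0 ?(ltW (m_gt0 _)).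
have [qy|] := ltP 0 (q eta y); last first.
  move=> h; have -> : q eta y = 0 by apply/le_anti; rewrite h q_ge0.
  rewrite mulr0 mul0r sub0r max_l// ?max_l// mulrN oppr_le0.
  by rewrite !mulr_ge0 ?(ltW (m_gt0 _)).
rewrite !mulrBr -!mulrA (square xy qx qy).
by congr (Num.max 0 (_ - _)); ring.
Qed.

Let sum_cross eta :
  \sum_x \sum_(y | y != x) m eta * q eta x * (exc eta x y * cross eta x y) = 0.
Proof.
set S := \sum_x _; suff : S = - S by lra.
rewrite {1}/S (exchange_big_dep xpredT)//= -sumrN; apply: eq_bigr => x _.
rewrite -sumrN; apply: eq_big => [y|y xy]; first by rewrite eq_sym.
have E := W_sym eta xy.
have C : cross eta y x = - cross eta x y by rewrite /cross opprB.
move: (cross eta y x) (cross eta x y) C E => c c' ->.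
move: (exc _ _ _) (exc _ _ _) => k k' E.
by rewrite mulrA -E; ring.
Qed.

Let sum_cross' :
  \sum_eta \sum_x \sum_(y | y != x)
    m eta * q eta x * (exc (tau x eta) x y * cross (tau x eta) x y) = 0.
Proof.
rewrite exchange_big/=.
under eq_bigr => x _.
  rewrite (reindex_inj (inv_inj (tauK x)))/=.
  under eq_bigr => eta _ do rewrite tauK -rev.
  over.
by rewrite exchange_big/= big1// => eta _; exact: sum_cross.
Qed.

Theorem flip_system_curvature (K : R) :
  (forall eta x, 0 < q eta x ->
     K <= (merge eta x + merge (tau x eta) x) / 2
          + Num.min (merge eta x) (merge (tau x eta) x)) ->
  K * (2^-1 * \sum_eta \sum_x m eta * q eta x
     * (log_mean (rho eta) (rho (tau x eta)) * (psi eta - psi (tau x eta)) ^+ 2))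
  <= \sum_eta \sum_x m eta * q eta x * edgeB eta x.
Proof.
rewrite -/th -/g => HK.
(* All contributions except those of merging jumps cancel in total, so [Z] may be spread over the
   edges and the claim checked edge by edge. *)
pose Z eta x := \sum_(y | y != x)
  (parallel eta x y + exc eta x y * cross eta x y
   + exc (tau x eta) x y * cross (tau x eta) x y).
have Z0 : \sum_eta \sum_x m eta * q eta x * Z eta x = 0.
  transitivity (\sum_eta \sum_x \sum_(y | y != x) m eta * q eta x * parallel eta x y
   + \sum_eta \sum_x \sum_(y | y != x) m eta * q eta x * (exc eta x y * cross eta x y)
   + \sum_eta \sum_x \sum_(y | y != x)
    m eta * q eta x * (exc (tau x eta) x y * cross (tau x eta) x y)).
    rewrite -!big_split; apply: eq_bigr => eta _; rewrite -!big_split.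
    apply: eq_bigr => x _; rewrite mulr_sumr -!big_split.
    by apply: eq_bigr => y _; rewrite !mulrDr.
  rewrite sum_cross' addr0 [X in _ + X]big1 ?addr0 => [|eta _]; last first.
    exact: sum_cross.
  rewrite exchange_big/= big1// => x _.
  rewrite exchange_big/= big1// => y yx.
  by rewrite sum_parallel// eq_sym.
have -> : K * (2^-1 * \sum_eta \sum_x m eta * q eta x * (th eta x * g eta x))
   = \sum_eta \sum_x m eta * q eta x * (2^-1 * K * (th eta x * g eta x) + 4^-1 * Z eta x).
  rewrite [RHS](eq_bigr (fun eta => K / 2 * (\sum_x m eta * q eta x * (th eta x * g eta x))
     + 4^-1 * \sum_x m eta * q eta x * Z eta x)).
    by rewrite big_split/= -!mulr_sumr Z0; ring.
  move=> eta _; rewrite !mulr_sumr -big_split; apply: eq_bigr => x _ /=; ring.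
apply: ler_sum => eta _; apply: ler_sum => x _.
have := q_ge0 eta x; rewrite le_eqVlt => /predU1P[<-|qx].
  by rewrite mulr0 !mul0r.
apply: ler_wpM2l; first by rewrite mulr_ge0// ltW.
have H := edge_B_ge qx; have HKx := HK _ _ qx.
rewrite -/(Z eta x) in H.
have T0 : 0 <= th eta x by exact: log_mean_ge0.
have T1 := log_mean_le_mean (rho_gt0 eta) (rho_gt0 (tau x eta)).
rewrite -/(th _ _) in T1.
have G0 : 0 <= g eta x by exact: sqr_ge0.
have r1 := rho_gt0 eta; have r2 := rho_gt0 (tau x eta).
have k1 := merge_ge0 qx.
have k2 : 0 <= merge (tau x eta) x by apply: merge_ge0; rewrite q_tau_gt0.
move: (g _ _) (th _ _) (Z _ _) (edgeB _ _) (merge _ _) (merge _ _)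
  (rho _) (rho _) H HKx T0 T1 G0 r1 r2 k1 k2.
move=> G T z B k' k r' r H HKx T0 T1 G0 r1 r2 k1 k2.
(* Up to the factor [G / 4]: the terms with [T] give [(k + k') * T], and the others are at least
   [Num.min k k' * (r + r')], where [r + r' >= 2 * T]. *)
suff : 2 * K * T <= k * (r + T) + k' * (r' + T).
  move=> /(ler_wpM2r G0); move: H; lra.
have : K * T <= ((k + k') / 2 + Num.min k k') * T by exact: ler_wpM2r.
have : Num.min k k' * (2 * T) <= k * r + k' * r'.
  have T2 : 2 * T <= r + r' by move: T1; lra.
  case: (leP k k') => kk; [have := ler_wpM2l k1 T2|have := ler_wpM2l k2 T2].
    have : 0 <= (k' - k) * r' by apply: mulr_ge0; lra.
    lra.
  have : 0 <= (k - k') * r by apply: mulr_ge0; lra.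
  lra.
lra.
Qed.

End FlipSystem.

(* [site eta x] is the only move at [x] which can have a positive rate in the
   state [eta]. *)
Theorem Ric_ge_flip (R : realType) (M : chain R) (V : finType)
    (site : state M -> V -> label M) (K : R) :
  let tau x eta := move (site eta x) eta in
  let q eta x := rate eta (site eta x) in
  (forall eta sg, 0 <= @rate R M eta sg) ->
  (forall eta (F : label M -> R), \sum_sg rate eta sg * F sg
     = \sum_x rate eta (site eta x) * F (site eta x)) ->
  flip_system tau q (@mass R M) ->
  (forall eta x, 0 < q eta x -> 0 <= merge_rate tau q eta x) ->
  (forall eta x, 0 < q eta x ->
     K <= (merge_rate tau q eta x + merge_rate tau q (tau x eta) x) / 2
          + Num.min (merge_rate tau q eta x) (merge_rate tau q (tau x eta) x)) ->
  Ric_ge M K.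
Proof.
move=> tau q r0 Hsite sys k0 HK rho psi rho0.
have E (F : state M -> label M -> R) :
    \sum_eta \sum_(sg | 0 < rate eta sg) mass eta * rate eta sg * F eta sg
    = \sum_eta \sum_x mass eta * q eta x * F eta (site eta x).
  apply: eq_bigr => eta _.
  transitivity (\sum_sg rate eta sg * (mass eta * F eta sg)).
    rewrite big_mkcond/=; apply: eq_bigr => sg _; case: ltP => [_|h]; first ring.
    by rewrite (_ : rate eta sg = 0) ?mul0r//; apply/le_anti; rewrite h r0.
  by rewrite Hsite; apply: eq_bigr => x _; rewrite /q; ring.
have genE f eta : generator f eta = flip_generator tau q f eta.
  exact: (Hsite eta (fun sg => f (move sg eta) - f eta)).
have := flip_system_curvature sys psi rho0 k0 HK; congr (_ <= _).
  congr (_ * (_ * _)).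
  rewrite -(E (fun eta sg => log_mean (rho eta) (rho (move sg eta))
    * (psi eta - psi (move sg eta)) ^+ 2)).
  by apply: eq_bigr => eta _; apply: eq_bigr => sg _; rewrite !mulrA.
pose Fc eta sg : R := (d1_log_mean (rho eta) (rho (move sg eta)) * generator rho eta
   + d2_log_mean (rho eta) (rho (move sg eta)) * generator rho (move sg eta))
   * (psi eta - psi (move sg eta)) ^+ 2.
pose Fd eta sg : R := log_mean (rho eta) (rho (move sg eta))
  * (psi eta - psi (move sg eta))
  * (generator psi eta - generator psi (move sg eta)).
transitivity (\sum_eta \sum_x mass eta * q eta x
    * (4^-1 * Fc eta (site eta x) - 2^-1 * Fd eta (site eta x))).
  apply: eq_bigr => eta _; apply: eq_bigr => x _; congr (_ * _).
  rewrite /edge_B /Fc /Fd !genE; congr (_ - _); by rewrite -mulrA.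
rewrite -(E (fun eta sg => 4^-1 * Fc eta sg - 2^-1 * Fd eta sg)).
rewrite /actionB /actionC /actionD !mulr_sumr -sumrB; apply: eq_bigr => eta _.
rewrite !mulr_sumr -sumrB; apply: eq_bigr => sg _.
by rewrite /Fc /Fd; ring.
Qed.

(** * Glauber dynamics with commuting involutive moves *)

Section GlauberCurvature.
Context {R : realType} (Omega G : finType) (act : G -> Omega -> Omega).
Context (H : Omega -> R) (beta : R).
Context (actK : forall x, involutive (act x)).
Context (actC : forall x y eta, act x (act y eta) = act y (act x eta)).

Let M := glauber act H beta.
Let q : Omega -> G -> R := @rate R M.

(** The energies telescope: [m eta * q eta x] depends only on the sum of the energies at both ends,
    and each side of the square relation only on the energy difference of opposite corners. *)
Let glauber_flip_system : flip_system act q (@mass R M).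
Proof.
split => //.
- move=> eta; rewrite /= mulr_gt0 ?expR_gt0// invr_gt0 (bigD1 eta)//=.
  by rewrite ltr_pwDl ?expR_gt0// sumr_ge0// => *; rewrite expR_ge0.
- by move=> eta x; rewrite /q/= expR_ge0.
- move=> eta x; rewrite /q/= actK -!mulrA -!expRD; congr (_ * expR _).
  by field.
- move=> eta x y xy _ _; rewrite /q/= -!expRD (actC x y); congr (expR _).
  by ring.
Qed.

Lemma Ric_ge_glauber (K : R) :
  (forall eta x, 0 <= merge_rate act q eta x) ->
  (forall eta x,
     K <= (merge_rate act q eta x + merge_rate act q (act x eta) x) / 2
          + Num.min (merge_rate act q eta x) (merge_rate act q (act x eta) x)) ->
  Ric_ge M K.
Proof.
move=> k0 HK; apply: (@Ric_ge_flip R M G (fun=> id)) => //.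
by move=> eta x; rewrite /= expR_ge0.
Qed.

End GlauberCurvature.

(** * Spin configurations and their flips *)

Section Spins.
Context {R : realType} {V : finType}.
Implicit Types (eta : {ffun V -> bool}) (x y : V).

Lemma flip_involutive x : involutive (@flip V x).
Proof.
move=> eta; apply/ffunP => y; rewrite !ffunE.
by case: eqP => //= _; rewrite negbK.
Qed.

Lemma flipC x y eta : flip x (flip y eta) = flip y (flip x eta).
Proof.
by apply/ffunP => z; rewrite !ffunE; do 2 case: eqP.
Qed.

Lemma spin_flip x eta y :
  spin (flip x eta) y = (if y == x then - spin eta y else spin eta y) :> R.
Proof. by rewrite /spin ffunE; case: eqP => //= _; case: (eta y); rewrite /= ?opprK. Qed.

Lemma spin_flip_eq x eta : spin (flip x eta) x = - spin eta x :> R.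
Proof. by rewrite spin_flip eqxx. Qed.

Lemma spin_flip_neq x eta y : y != x -> spin (flip x eta) y = spin eta y :> R.
Proof. by rewrite spin_flip => /negPf->. Qed.

Lemma spinM x y eta :
  spin eta x * spin eta y = (if eta x == eta y then 1 else -1) :> R.
Proof. by rewrite /spin; case: (eta x); case: (eta y) => /=; ring. Qed.

Lemma spin2 x eta : spin eta x * spin eta x = 1 :> R.
Proof. by rewrite spinM eqxx. Qed.

End Spins.

Lemma expR_addN_ge2 (R : realType) (x : R) : 2 <= expR x + expR (- x).
Proof.
have := expR_gt0 x; have := expR_gt0 (- x).
have : expR x * expR (- x) = 1 by rewrite expRxMexpNx_1.
move: (expR x) (expR (- x)) => u v uv v0 u0.
have := sqr_ge0 (u - v); nra.
Qed.

(** * The Curie-Weiss model of size [n.+1] *)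

Section CurieWeiss.
Context {R : realType} (n : nat) (beta : R).
Local Notation M := (curie_weiss n.+1 beta).
Let q : {ffun 'I_n.+1 -> bool} -> 'I_n.+1 -> R := @rate R M.
Let b : R := beta / n.+1%:R.
Let S (eta : {ffun 'I_n.+1 -> bool}) : R := \sum_j spin eta j.

Let S_flip eta i : S (flip i eta) = S eta - 2 * spin eta i.
Proof.
rewrite /S (bigD1 i)//= [in RHS](bigD1 i)//= spin_flip_eq.
rewrite (eq_bigr (fun j => spin eta j)) => [|j]; first by ring.
exact: spin_flip_neq.
Qed.

(** The [- 1] removes the self-interaction of site [i], which a flip leaves unchanged. *)
Let rateE eta i : q eta i = expR (- b * (spin eta i * S eta - 1)).
Proof.
have HE xi : curie_weiss_H xi = - (2 * n.+1%:R)^-1 * (S xi * S xi) :> R.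
  by rewrite /curie_weiss_H /S big_distrlr.
rewrite /q/= !HE S_flip; congr expR.
have n0 : n.+1%:R != 0 :> R by rewrite pnatr_eq0.
have := spin2 (R := R) i eta; move: (spin eta i) (S eta) => s t s2.
have -> : (t - 2 * s) * (t - 2 * s) = t * t - 4 * (s * t) + 4 * (s * s) by ring.
by rewrite s2 /b; move: n.+1%:R n0 => N N0; field.
Qed.

Let agree (eta : {ffun 'I_n.+1 -> bool}) i : R := \sum_(j | j != i) (eta j == eta i)%:R.

Let sum1 i : \sum_(j < n.+1 | j != i) (1 : R) = n%:R.
Proof. by rewrite sumr_const (cardC1 i) card_ord. Qed.

Let agree_bounds eta i : 0 <= agree eta i <= n%:R.
Proof.
rewrite -(sum1 i) /agree sumr_ge0//=; apply: ler_sum => j _.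
by rewrite lern1 leq_b1.
Qed.

Let agree_flip eta i : agree (flip i eta) i = n%:R - agree eta i.
Proof.
rewrite -(sum1 i) /agree -sumrB; apply: eq_bigr => j ji.
rewrite !ffunE eqxx (negPf ji).
by case: (eta i); case: (eta j); rewrite /= ?subr0 ?subrr.
Qed.

Let spinS eta i : spin eta i * S eta - 1 = 2 * agree eta i - n%:R.
Proof.
rewrite -(sum1 i) /agree [in RHS]mulr_sumr -sumrB /S (bigD1 i)//= mulrDr spin2.
rewrite addrAC subrr add0r mulr_sumr; apply: eq_bigr => j ji.
rewrite spinM eq_sym; case: eqP => _ /=; ring.
Qed.

Context (beta_gt0 : 0 < beta) (beta_le : beta <= 2^-1).

Let b_gt0 : 0 < b.
Proof. by rewrite divr_gt0. Qed.

(** Sites that disagree with [i] have no surplus. Those that agree have the same rate as [i], and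
    flipping [i] multiplies it by [expR (2 * b)]. *)
Let merge_rateE eta i : merge_rate (@flip 'I_n.+1) q eta i =
  expR (- b * (2 * agree eta i - n%:R)) * (1 - agree eta i * (expR (2 * b) - 1)).
Proof.
rewrite /merge_rate rateE spinS [RHS]mulrBr mulr1; congr (_ - _).
rewrite [in X in _ = _ * X]/agree mulr_suml mulr_sumr; apply: eq_bigr => j ji.
rewrite /excess flip_involutive !rateE S_flip (spin_flip_neq _ ji).
rewrite -spinS.
have sj : spin eta j = (if eta j == eta i then spin eta i else - spin eta i) :> R.
  by rewrite /spin; case: (eta j); case: (eta i); rewrite /= ?opprK.
have s2 := spin2 (R := R) i eta.
have sS : spin eta i * (S eta - 2 * spin eta i) = spin eta i * S eta - 2.
  by rewrite mulrBr [_ * (2 * _)]mulrCA s2 mulr1.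
have E2 : 0 < expR (2 * b) - 1 by rewrite subr_gt0 expR_gt1; move: b_gt0; lra.
case: eqP sj => _ -> /=.
  have -> : - b * (spin eta i * (S eta - 2 * spin eta i) - 1)
      = - b * (spin eta i * S eta - 1) + 2 * b by rewrite sS; ring.
  rewrite expRD max_r; first by ring.
  by rewrite -[X in _ - X]mulr1 -mulrBr mulr_ge0 ?expR_ge0// ltW.
rewrite mul0r mulr0 max_l// subr_le0 ler_expR !mulNr sS.
by move: b_gt0; lra.
Qed.

(** As [2 * beta <= 1], [n] is at most [n.+1 * (1 - 2 * b)], and [expR (2 * b) * (1 - 2 * b) <= 1].
    Having no error term here gives a bound valid at every size. *)
Let n_rate : n%:R * (expR (2 * b) - 1) <= 2 * beta.
Proof.
have n0 : 0 < n.+1%:R :> R by rewrite ltr0n.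
have bE : b * n.+1%:R = beta by rewrite /b divfK ?gt_eqF.
have e1 : 1 < expR (2 * b) by rewrite expR_gt1; move: b_gt0; lra.
have e2 : expR (2 * b) * (1 - 2 * b) <= 1.
  rewrite -[leRHS](expRxMexpNx_1 (2 * b)) ler_pM2l ?expR_gt0//.
  exact: expR_ge1Dx.
have H1 : n%:R * (expR (2 * b) - 1)
    <= n.+1%:R * (1 - 2 * b) * (expR (2 * b) - 1).
  apply: ler_wpM2r; first by lra.
  by move: beta_le; rewrite -bE -natr1; lra.
apply: (le_trans H1); rewrite -bE.
have := ler_wpM2l (ltW n0) e2; lra.
Qed.

Lemma Ric_ge_curie_weiss :
  Ric_ge M ((1 - beta) + (1 - 2 * beta) * expR (- beta)).
Proof.
(* For the minimum of the merging rates: the exponential is least at [k = n], where [b * n <= beta],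
   and the other factor is at least [1 - 2 * beta] by [n_rate]. *)
have lower (k : R) : 0 <= k <= n%:R ->
    (1 - 2 * beta) * expR (- beta)
    <= expR (- b * (2 * k - n%:R)) * (1 - k * (expR (2 * b) - 1)).
  move=> /andP[k0 kn]; rewrite mulrC.
  have bn : b * n%:R <= beta.
    have <- : b * n.+1%:R = beta by rewrite /b divfK ?pnatr_eq0.
    by rewrite ler_pM2l// ler_nat.
  have e1 : 1 < expR (2 * b) by rewrite expR_gt1; move: b_gt0; lra.
  apply: ler_pM; rewrite ?expR_ge0//; first by move: beta_le; lra.
    rewrite ler_expR; apply: (@le_trans _ _ (- b * n%:R)); first by lra.
    by rewrite !mulNr lerN2 ler_pM2l//; lra.
  have := ler_wpM2r (_ : 0 <= expR (2 * b) - 1) kn; move: n_rate; lra.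
have Dk eta i : (2 * agree (flip i eta) i - n%:R) = - (2 * agree eta i - n%:R).
  by rewrite agree_flip; ring.
have l1 eta i := lower _ (agree_bounds eta i).
apply: Ric_ge_glauber => [x|x y eta|eta i|eta i].
- exact: flip_involutive.
- exact: flipC.
- rewrite -/q merge_rateE; apply: le_trans (l1 eta i).
  by rewrite mulr_ge0 ?expR_ge0//; move: beta_le; lra.
rewrite -/q; apply: lerD; last first.
  by rewrite le_min !merge_rateE !l1.
rewrite !merge_rateE Dk agree_flip.
have /andP[] := agree_bounds eta i; move: n_rate.
have : 0 <= expR (2 * b) - 1 by rewrite subr_ge0 ltW// expR_gt1; move: b_gt0; lra.
move: (agree eta i) (expR (2 * b) - 1) => k d d0 dn k0 kn.
have U2 := expR_addN_ge2 (b * (2 * k - n%:R)).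
rewrite mulrNN mulNr.
(* A Chebyshev argument for the mean: the two factors have the same sign, so replacing [k] and
   [n - k] by [n / 2] does not increase the sum of the merging rates. *)
have T0 : 0 <= (2 * k - n%:R)
    * (expR (b * (2 * k - n%:R)) - expR (- (b * (2 * k - n%:R)))).
  have [h|h] := leP 0 (2 * k - n%:R).
    apply: mulr_ge0 => //; rewrite subr_ge0 ler_expR ge0_cp//.
    by rewrite mulr_ge0// ltW.
  rewrite nmulr_rge0// subr_le0 ler_expR.
  have : b * (2 * k - n%:R) <= 0 by rewrite pmulr_rle0// ltW.
  lra.
move: U2 T0; move: (expR _) (expR _) => v u U2 T0.
have := mulr_ge0 d0 T0.
(* After that replacement the sum is [u + v], at least 2, times a factor of at least [1 - beta]. *)
have : 0 <= (u + v - 2) * (1 - n%:R * d / 2).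
  by apply: mulr_ge0; move: beta_le; lra.
lra.
Qed.

End CurieWeiss.

(** * The Ising model on a graph of degree at most [D] *)

Section IsingGraph.
Context {R : realType} (V : finType) (e : rel V) (D : nat) (beta : R).
Context (e_sym : symmetric e) (e_irr : irreflexive e).
Context (e_deg : forall x, (#|[pred y | e x y]| <= D)%N).
Context (beta_gt0 : 0 < beta).
Implicit Type eta : {ffun V -> bool}.

Let H eta : R :=
  - 2^-1 * \sum_x \sum_(y | e x y) spin eta x * spin eta y.
Let M := glauber (@flip V) H beta.
Let q : {ffun V -> bool} -> V -> R := @rate R M.
Let field_at eta x : R := \sum_(y | e x y) spin eta y.

Let field_flip eta x y :
  field_at (flip x eta) y = field_at eta y - (if e y x then 2 * spin eta x else 0).
Proof.
rewrite /field_at; case: ifPn => exy; last first.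
  rewrite subr0; apply: eq_bigr => z eyz; apply: spin_flip_neq.
  by apply: contraNneq exy => <-.
rewrite (bigD1 x)//= [in RHS](bigD1 x)//= spin_flip_eq.
rewrite (eq_bigr (fun z => spin eta z)) => [|z /andP[_]]; first by ring.
exact: spin_flip_neq.
Qed.

Let rateE eta x : q eta x = expR (- beta * (spin eta x * field_at eta x)).
Proof.
have HE xi : H xi = - 2^-1 * \sum_y spin xi y * field_at xi y.
  by congr (_ * _); apply: eq_bigr => y _; rewrite mulr_sumr.
rewrite /q/=; congr expR; rewrite !HE.
(* Each bond at [x] is counted from both of its ends and changes sign, hence the factor 4. *)
have -> : \sum_y spin (flip x eta) y * field_at (flip x eta) y
    = \sum_y spin eta y * field_at eta y - 4 * (spin eta x * field_at eta x).
  rewrite (bigD1 x)//= [in RHS](bigD1 x)//= spin_flip_eq field_flip e_irr subr0.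
  rewrite (eq_bigr (fun y => spin eta y * field_at eta y
    - (if e y x then 2 * spin eta x * spin eta y else 0))) => [|y yx]; last first.
    rewrite (spin_flip_neq _ yx) field_flip mulrBr; congr (_ - _).
    by case: ifP => _; rewrite ?mulr0//; ring.
  have -> : \sum_(y | y != x) (spin eta y * field_at eta y -
      (if e y x then 2 * spin eta x * spin eta y else 0))
    = \sum_(y | y != x) spin eta y * field_at eta y
      - 2 * spin eta x * field_at eta x.
    rewrite sumrB -big_mkcondr/= -mulr_sumr; congr (_ - _ * _).
    apply: eq_bigl => y; rewrite e_sym; case: eqP => //= ->.
    by rewrite e_irr.
  ring.
by field.
Qed.

(** Bounds the surplus at one neighbour: a rate is at most [expR (beta * D%:R)], and aligning one
    more neighbour multiplies it by [expR (- 2 * beta)]. *)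
Let eps : R := (1 - expR (- 2 * beta)) * expR (beta * D%:R).

Let eps_ge0 : 0 <= eps.
Proof.
rewrite mulr_ge0 ?expR_ge0// subr_ge0 -[leRHS]expR0 ler_expR; move: beta_gt0; lra.
Qed.

Let field_le eta x : `|spin eta x * field_at eta x| <= D%:R.
Proof.
have s1 y : `|spin eta y| = 1 :> R.
  by rewrite /spin; case: (eta y); rewrite ?normrN normr1.
rewrite normrM s1 mul1r; apply: (le_trans (ler_norm_sum _ _ _)).
under eq_bigr do rewrite s1.
by rewrite sumr_const ler_nat; exact: e_deg.
Qed.

Let rate_ge eta x : expR (- beta * D%:R) <= q eta x.
Proof.
rewrite rateE ler_expR !mulNr lerN2 ler_pM2l//.
by have := field_le eta x; rewrite ler_norml => /andP[].
Qed.

Let rate_le eta x : q eta x <= expR (beta * D%:R).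
Proof.
rewrite rateE ler_expR mulNr -mulrN ler_pM2l//.
by have := field_le eta x; rewrite ler_norml lerNl => /andP[].
Qed.

Let agree eta x : R := \sum_(y | y != x) (e x y && (eta y == eta x))%:R.

Let agree_ge0 eta x : 0 <= agree eta x.
Proof. exact: sumr_ge0. Qed.

(** A neighbour agrees with [x] either before or after the flip of [x], never both. *)
Let agreeD eta x : agree eta x + agree (flip x eta) x <= D%:R.
Proof.
rewrite /agree -big_split/=.
apply: (@le_trans _ _ (\sum_(y | e x y) 1)); last first.
  by rewrite sumr_const ler_nat; exact: e_deg.
rewrite [leRHS]big_mkcond [leLHS]big_mkcond/=; apply: ler_sum => y _.
rewrite !ffunE eqxx; case: eqP => [_|_]; first by case: ifP.
by case: (e x y); case: (eta y); case: (eta x); rewrite /= ?addr0 ?add0r.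
Qed.

Let merge_rate_ge eta x :
  q eta x - agree eta x * eps <= merge_rate (@flip V) q eta x.
Proof.
rewrite /merge_rate lerD2l lerN2 /agree mulr_suml; apply: ler_sum => y yx.
rewrite /excess flip_involutive.
have := rate_le (flip x eta) y; rewrite !rateE field_flip (spin_flip_neq _ yx).
rewrite (e_sym y x); case: (e x y) => /=; last first.
  by rewrite subr0 subrr maxxx mul0r.
have -> : spin eta y * (field_at eta y - 2 * spin eta x) =
    spin eta y * field_at eta y - 2 * (spin eta y * spin eta x) by ring.
rewrite spinM; set t := spin eta y * _; case: eqP => _ /= le.
  rewrite mul1r ge_max eps_ge0/= /eps.
  have -> : - beta * t = - beta * (t - 2 * 1) + - 2 * beta by ring.
  rewrite expRD -[X in X - _]mulr1 -mulrBr mulrC ler_wpM2l//.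
  by rewrite subr_ge0 -[leRHS]expR0 ler_expR; move: beta_gt0; lra.
rewrite mul0r ge_max lexx/= subr_le0 ler_expR; move: beta_gt0; lra.
Qed.

(** The rates at the two ends of an edge are reciprocal, so their mean is at least 1. Surpluses cost
    [D * eps] in the minimum but only half of that in the mean, where the agreement counts add up to
    at most [D]; hence [3 / 2]. *)
Lemma Ric_ge_ising_graph : D%:R * eps <= expR (- beta * D%:R) ->
  Ric_ge M (1 + expR (- beta * D%:R) - 3 / 2 * (D%:R * eps)).
Proof.
move=> small.
have low eta x : expR (- beta * D%:R) - D%:R * eps <= merge_rate (@flip V) q eta x.
  apply: le_trans (merge_rate_ge eta x); apply: lerB; first exact: rate_ge.
  apply: ler_wpM2r => //; have := agreeD eta x; have := agree_ge0 (flip x eta) x.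
  lra.
apply: Ric_ge_glauber => [x|x y eta|eta x|eta x].
- exact: flip_involutive.
- exact: flipC.
- by apply: le_trans (low eta x); rewrite subr_ge0.
rewrite -/q.
have mn : expR (- beta * D%:R) - D%:R * eps <=
  Num.min (merge_rate (@flip V) q eta x) (merge_rate (@flip V) q (flip x eta) x).
  by rewrite le_min !low.
have av : 2 <= q eta x + q (flip x eta) x.
  rewrite !rateE spin_flip_eq field_flip e_irr subr0 addrC.
  by rewrite [_ * (- _ * _)](_ : _ = - (- beta * (spin eta x * field_at eta x))); [rewrite addrC; exact: expR_addN_ge2|ring].
have m1 := merge_rate_ge eta x; have m2 := merge_rate_ge (flip x eta) x.
have := ler_wpM2r eps_ge0 (agreeD eta x).
move: mn av m1 m2; lra.
Qed.

End IsingGraph.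

(** * The Ising model on finite subsets of the integer lattice *)

Lemma lattice_degree (d : nat) (Lam : {fset 'rV[int]_d}) (x : Lam) :
  (#|[pred y : Lam | lattice_adj (val x) (val y)]| <= 2 * d)%N.
Proof.
pose nb (ib : 'I_d * bool) : 'rV[int]_d :=
  val x + (if ib.2 then 1 else -1) *: delta_mx 0 ib.1.
have sub (y : Lam) : lattice_adj (val x) (val y) ->
    val y \in codom nb.
  move=> /eqP adj.
  have [i xyi] : exists i, val x 0 i - val y 0 i != 0.
    apply/existsP; apply: contra_eqT adj => /existsPn h.
    rewrite big1 => // i _.
    by have := h i; rewrite negbK => /eqP->; rewrite normr0.
  move: adj; rewrite (bigD1 i)//= => adj.
  (* A nonzero integer difference already uses up the whole sum, so all other coordinates agree. *)
  have ge1 : 1 <= `|val x 0 i - val y 0 i| :> int.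
    by rewrite -gtz0_ge1 normr_gt0.
  have rest0 : \sum_(j < d | j != i) `|val x 0 j - val y 0 j| = 0.
    apply/le_anti; rewrite sumr_ge0// andbT.
    by rewrite -(lerD2l `|val x 0 i - val y 0 i|) adj addr0.
  have xyj j : j != i -> val y 0 j = val x 0 j.
    move=> ji; apply/esym/eqP; rewrite -subr_eq0 -normr_eq0.
    have /eqP := rest0; rewrite psumr_eq0// => /allP/(_ j (mem_index_enum j)).
    by rewrite ji.
  apply/codomP; exists (i, val x 0 i < val y 0 i).
  apply/rowP => j; rewrite /nb !mxE eqxx /=.
  have [->|/xyj->] := eqVneq j i; last by rewrite mulr0 addr0.
  rewrite mulr1; move: adj; rewrite rest0 addr0.
  by move: (val x 0 i) (val y 0 i) => a c; case: ltP; lia.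
rewrite cardE -(size_map val).
apply: (@leq_trans (size (codom nb))).
  apply: uniq_leq_size; first by rewrite (map_inj_uniq val_inj) enum_uniq.
  by move=> _ /mapP[y + ->]; rewrite mem_enum; exact: sub.
by rewrite size_codom card_prod card_ord card_bool mulnC.
Qed.

Lemma Ric_ge_ising (R : realType) (d : nat) (beta : R) (Lam : {fset 'rV[int]_d}) :
  0 < beta ->
  2 * d%:R * (1 - expR (- 2 * beta)) * expR (4 * d%:R * beta) <= 1 ->
  Ric_ge (ising Lam beta)
    (1 + expR (- 2 * beta * d%:R)
       - 3 * d%:R * (1 - expR (- 2 * beta)) * expR (2 * beta * d%:R)).
Proof.
move=> beta0 small.
have e_sym : symmetric (fun u v : Lam => lattice_adj (val u) (val v)).
  move=> u v; rewrite /lattice_adj; congr (_ == _).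
  by apply: eq_bigr => i _; rewrite distrC.
have e_irr : irreflexive (fun u v : Lam => lattice_adj (val u) (val v)).
  by move=> u; rewrite /lattice_adj big1 // => i _; rewrite subrr normr0.
have := Ric_ge_ising_graph e_sym e_irr (@lattice_degree d Lam) beta0.
have -> : (- beta * (2 * d)%:R) = - 2 * beta * d%:R by rewrite natrM; ring.
have -> : (beta * (2 * d)%:R) = 2 * beta * d%:R by rewrite natrM; ring.
rewrite natrM.
set E := expR (2 * beta * d%:R); set F := expR (- 2 * beta * d%:R).
have EF : E * F = 1 by rewrite /E /F !mulNr expRxMexpNx_1.
have E0 : 0 < E by exact: expR_gt0.
have E4 : expR (4 * d%:R * beta) = E * E by rewrite /E -expRD; congr expR; ring.
move=> H.
have -> : 1 + F - 3 * d%:R * (1 - expR (- 2 * beta)) * E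
  = 1 + F - 3 / 2 * (2 * d%:R * ((1 - expR (- 2 * beta)) * E)) by field.
(* Multiplied by [E], the smallness condition becomes the hypothesis, as [E * F = 1] and the
   exponential there is [E * E]. *)
apply: H; rewrite -(ler_pM2l E0) EF; move: small; rewrite E4.
by apply: le_trans; rewrite le_eqVlt; apply/orP; left; apply/eqP; ring.
Qed.

(** * The hardcore model *)

Section Hardcore.
Context {R : realType} (V : finType) (e : rel V) (beta : R).
Context (e_sym : symmetric e) (e_irr : irreflexive e) (beta_gt0 : 0 < beta).
Local Notation M := (hardcore e beta).
Local Notation Delta := ((max_degree e)%:R : R).
Implicit Types (eta : hc_state e) (x y : V).

(** Only removal is possible at an occupied vertex and only insertion at an empty one, so the two
    labels at [x] combine into one involution [tau x]. *)
Let site (eta : hc_state e) (x : V) : V * bool := (x, ~~ val eta x).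
Let tau (x : V) (eta : hc_state e) : hc_state e := hc_move (site eta x) eta.
Let q (eta : hc_state e) (x : V) : R := hc_rate beta eta (site eta x).
Let free (eta : hc_state e) (x : V) : bool := [forall y, e x y ==> ~~ val eta y].

Let independentP eta x y : e x y -> val eta x -> ~~ val eta y.
Proof.
move=> exy etax; have /forallP/(_ x)/forallP/(_ y) := valP eta.
by rewrite exy etax.
Qed.

Let occ_free eta x : val eta x -> free eta x.
Proof. by move=> h; apply/forallP => y; apply/implyP => /independentP; exact. Qed.

Let freeP eta x y : free eta x -> e x y -> ~~ val eta y.
Proof. by move=> /forallP/(_ y)/implyP. Qed.

Let tauE eta x :
  val (tau x eta) = if free eta x then flip x (val eta) else val eta.
Proof.
rewrite /tau /hc_move val_insubd.
have -> : [ffun y => if y == (site eta x).1 then (site eta x).2 else val eta y]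
    = flip x (val eta).
  by apply/ffunP => y; rewrite !ffunE /=; case: eqP => // ->.
suff -> : independent e (flip x (val eta)) = free eta x by [].
apply/idP/idP => [ind|fr].
  have [/occ_free//|nx] := boolP (val eta x).
  apply/forallP => y; apply/implyP => exy.
  move: ind => /forallP/(_ x)/forallP/(_ y)/implyP/(_ exy).
  rewrite !ffunE eqxx (negPf nx) /=; case: eqP => // yx.
  by move: exy; rewrite yx e_irr.
apply/forallP => u; apply/forallP => v; apply/implyP => euv; rewrite !ffunE.
case: eqP => [ux|_]; case: eqP => [vx|_].
- by move: euv; rewrite ux vx e_irr.
- by move: euv; rewrite ux => /(freeP fr)/negPf->; rewrite andbF.
- by move: euv; rewrite vx e_sym => /(freeP fr)/negPf->.
- by apply/negP => /andP[/(independentP euv)/negP].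
Qed.

Let tau_free eta x : free eta x -> val (tau x eta) = flip x (val eta).
Proof. by rewrite tauE => ->. Qed.

Let tau_neq eta x y : y != x -> val (tau x eta) y = val eta y.
Proof. by move=> yx; rewrite tauE; case: ifP => _ //; rewrite ffunE (negPf yx). Qed.

Let tau_eq eta x : free eta x -> val (tau x eta) x = ~~ val eta x.
Proof. by move=> fr; rewrite tau_free// ffunE eqxx. Qed.

Let free_tau eta x y : ~~ e x y -> free (tau x eta) y = free eta y.
Proof.
move=> nexy; apply: eq_forallb => z.
have [->|zx] := eqVneq z x; first by rewrite e_sym (negPf nexy).
by rewrite tau_neq.
Qed.

Let free_adj eta x y : e x y -> val eta x -> free eta y = false.
Proof.
move=> exy etax; apply/negbTE/negP => fy.
by move: exy; rewrite e_sym => /(freeP fy); rewrite etax.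
Qed.

Let tauK x : involutive (tau x).
Proof.
move=> eta; apply: val_inj; rewrite [LHS]tauE free_tau ?e_irr//.
rewrite tauE; case: (free eta x) => //; exact: flip_involutive.
Qed.

Let prod_empty (P : pred V) (f : V -> bool) :
  \prod_(y | P y) (1 - (f y)%:R : R) = [forall y, P y ==> ~~ f y]%:R.
Proof.
have [h|h] := boolP [forall y, P y ==> ~~ f y].
  rewrite big1 // => y Py; move: h => /forallP/(_ y); rewrite Py /= => /negPf->.
  by rewrite subr0.
move: h; rewrite negb_forall => /existsP[y]; rewrite negb_imply negbK => /andP[Py fy].
by rewrite (bigD1 y)//= fy subrr mul0r.
Qed.

Let qE eta x : q eta x = if free eta x then (if val eta x then 1 else beta) else 0.
Proof.
rewrite /q /hc_rate /=; case: ifPn => [nx|]; last first.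
  by rewrite negbK => etax; rewrite occ_free// etax.
rewrite (negPf nx) prod_empty.
rewrite (_ : [forall y, _] = free eta x); first by case: ifP; rewrite ?mulr1 ?mulr0.
apply/forallP/forallP => h y; have := h y; first by case: (e x y); rewrite ?orbT.
by case: eqP => //= ->; rewrite nx.
Qed.

Let q_gt0 eta x : (0 < q eta x) = free eta x.
Proof.
by rewrite qE; case: (free eta x); [case: (val eta x); rewrite ?ltr01|rewrite ltxx].
Qed.

(** Adjacent free vertices are both empty, and filling either one blocks the other. *)
Let square_free eta x y : x != y -> free eta x -> free eta y ->
  free (tau x eta) y = free (tau y eta) x.
Proof.
move=> xy fx fy; have [exy|nexy] := boolP (e x y); last first.
  by rewrite !free_tau ?fx ?fy// e_sym.
have eyx : e y x by rewrite e_sym.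
by rewrite (free_adj exy) ?(free_adj eyx) ?tau_eq// ?(freeP fx exy) ?(freeP fy eyx).
Qed.

Let hardcore_flip_system : flip_system tau q (@mass R M).
Proof.
split => //.
- move=> eta; rewrite /= mulr_gt0//.
    rewrite invr_gt0 (bigD1 eta)//= ltr_pwDl//.
      by apply: prodr_gt0 => x _; rewrite exprn_gt0.
    by apply: sumr_ge0 => xi _; apply: prodr_ge0 => x _; rewrite exprn_ge0// ltW.
  by apply: prodr_gt0 => x _; rewrite exprn_gt0.
- by move=> eta x; rewrite qE; do 2 case: ifP => // _; exact: ltW.
- move=> eta x; rewrite /= !qE free_tau ?e_irr//; case: ifPn => [fr|_]; last first.
    by rewrite !mulr0.
  rewrite -!mulrA; congr (_ * _); rewrite /hc_weight (bigD1 x)//= [in RHS](bigD1 x)//=.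
  rewrite [in RHS](eq_bigr (fun y => beta ^+ val eta y)) => [|y yx]; last first.
    by rewrite tau_neq.
  by rewrite tau_eq//; case: (val eta x); rewrite /= ?expr0 ?expr1; ring.
- move=> eta x y xy; rewrite !q_gt0 => fx fy; rewrite !qE fx fy.
  rewrite (square_free xy fx fy) !tau_neq//; last by rewrite eq_sym.
  by case: (free _ _); rewrite ?mulr0// mulrC.
- move=> eta x y xy; rewrite !q_gt0 => fx fy fxy; apply: val_inj.
  rewrite !(tau_free, =^~ square_free xy fx fy)//.
  exact: flipC.
Qed.

(** Filling [x] blocks its neighbours and leaves the rates at other vertices unchanged, so there is
    no surplus to subtract. *)
Let merge_vacant eta x : free eta x -> ~~ val eta x -> beta <= merge_rate tau q eta x.
Proof.
move=> fr nx; rewrite /merge_rate big1 => [|y yx].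
  by rewrite subr0 qE fr (negPf nx).
rewrite /excess tauK !qE tau_neq//; have [exy|nexy] := boolP (e x y).
  rewrite (free_adj exy) ?tau_eq//; apply/max_l.
  by rewrite sub0r oppr_le0; do 2 case: ifP => // _; exact: ltW.
by rewrite free_tau// subrr maxxx.
Qed.

(** Emptying [x] raises rates only at its neighbours, at most [Delta] in number, and each from 0 to
    at most [beta]. *)
Let merge_occupied eta x : val eta x -> 1 - beta * Delta <= merge_rate tau q eta x.
Proof.
move=> etax; have fr := occ_free etax.
rewrite /merge_rate {1}qE fr etax lerD2l lerN2.
apply: (@le_trans _ _ (\sum_(y | e x y) beta)); last first.
  rewrite sumr_const -[leLHS]mulr_natr ler_pM2l// ler_nat.
  exact: (leq_bigmax x).
rewrite big_mkcond [leRHS]big_mkcond; apply: ler_sum => y _ /=.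
case: ifP => [yx|_]; last by case: ifP => // _; exact: ltW.
rewrite /excess tauK !qE tau_neq//; have [exy|nexy] := boolP (e x y).
  rewrite (free_adj exy etax) (negPf (freeP fr exy)) subr0.
  by rewrite ge_max (ltW beta_gt0); case: (free _ _); rewrite ?lexx ?(ltW beta_gt0).
by rewrite free_tau// subrr maxxx.
Qed.

Let sum_site eta (F : V * bool -> R) :
  \sum_g hc_rate beta eta g * F g = \sum_x q eta x * F (site eta x).
Proof.
rewrite (eq_bigr (fun g => hc_rate beta eta (g.1, g.2) * F (g.1, g.2))); last first.
  by case.
rewrite -(pair_bigA _ (fun x b => hc_rate beta eta (x, b) * F (x, b)))/=.
apply: eq_bigr => x _; rewrite big_bool /q /site.
have [etax|nx] := boolP (val eta x) => /=.
  by rewrite /hc_rate/= (bigD1 x) ?eqxx//= etax subrr mul0r mulr0 mul0r add0r.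
by rewrite {2}/hc_rate/= (negPf nx) mul0r addr0.
Qed.

(** Every edge joins a state with [x] empty to one with [x] occupied, so one merging rate is at
    least [beta] and the other at least [1 - beta * Delta]; the first summand is the mean of these
    bounds. *)
Lemma Ric_ge_hardcore : beta * Delta <= 1 ->
  Ric_ge M ((1 - beta * (Delta - 1)) / 2 + Num.min beta (1 - beta * Delta)).
Proof.
move=> small.
have rates eta x : 0 < q eta x ->
    beta <= merge_rate tau q eta x /\ 1 - beta * Delta <= merge_rate tau q (tau x eta) x
    \/ 1 - beta * Delta <= merge_rate tau q eta x /\ beta <= merge_rate tau q (tau x eta) x.
  rewrite q_gt0 => fr; have [etax|nx] := boolP (val eta x); [right|left]; split.
  - exact: merge_occupied.
  - by apply: merge_vacant; rewrite ?free_tau ?e_irr// tau_eq// negbK.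
  - exact: merge_vacant.
  - by apply: merge_occupied; rewrite tau_eq.
apply: (@Ric_ge_flip R M V site) => //.
- move=> eta [x b]; rewrite /= /hc_rate /=; case: b => //.
  by rewrite mulr_ge0 ?(ltW beta_gt0)// prod_empty.
- by move=> eta x /rates[|] [h1 h2]; apply: le_trans h1; rewrite ?subr_ge0// ltW.
move=> eta x /rates[|] [h1 h2].
  apply: lerD; first by lra.
  by rewrite le_min !ge_min h1 h2 orbT.
apply: lerD; first by lra.
by rewrite le_min !ge_min h1 h2 orbT.
Qed.

End Hardcore.

Theorem theorem1p1 (R : realType) :
  (* Curie-Weiss *)
  (forall beta : R, 0 < beta -> beta <= 2^-1 ->
     (((1 - beta) + (1 - 2 * beta) * expR (- beta))%:E
        <= limn_einf (fun n : nat => Ric_sup (curie_weiss n.+1 beta)))%E)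
  /\
  (* Ising *)
  (forall (d : nat) (beta : R), (1 <= d)%N -> 0 < beta ->
     2 * d%:R * (1 - expR (- 2 * beta)) * expR (4 * d%:R * beta) <= 1 ->
     forall Lam : {fset 'rV[int]_d}, lattice_connected Lam ->
       Ric_ge (ising Lam beta)
         (1 + expR (- 2 * beta * d%:R)
            - 3 * d%:R * (1 - expR (- 2 * beta)) * expR (2 * beta * d%:R)))
  /\
  (* hardcore *)
  (forall (V : finType) (e : rel V) (beta : R),
     symmetric e -> irreflexive e -> (forall x y : V, connect e x y) ->
     0 < beta -> beta * (max_degree e)%:R <= 1 ->
     Ric_ge (hardcore e beta)
       ((1 - beta * ((max_degree e)%:R - 1)) / 2
          + Num.min beta (1 - beta * (max_degree e)%:R))).
Proof.
split; last split.
(* The bound holds at every size, hence for all tail infima and for their limit. *)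
- move=> beta beta0 beta_le; rewrite limn_einf_lim.
  apply: lime_ge; first exact: is_cvg_einfs.
  apply: nearW => n; apply: le_ereal_inf_tmp => _ [k _ <-].
  by apply: ereal_sup_ubound; eexists; first exact: Ric_ge_curie_weiss.
- by move=> d beta _ beta0 small Lam _; exact: Ric_ge_ising.
- by move=> V e beta e_sym e_irr _ beta0; exact: Ric_ge_hardcore.
Qed.
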